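(* For every integer $\gamma\geqslant 0$ there exists an integer $g$ (depending only on $\gamma$) such that every finite simple graph $G$ of genus $\gamma$ and girth at least $g$ satisfies $\mu_s(G)\leqslant(s^2+s)(s^2+s+1)$ for every integer $s\geqslant 1$; in particular $\mu(G)\leqslant 6$.
   Context: Let $G$ be a finite simple graph on the vertex set $\{1,\dots,n\}$, let $s\geqslant 1$ be an integer and let $\Gamma$ be a finite set of colors. In the game with $s$ guesses, a strategy for vertex $i$ is a function $F_i$ assigning to each $(x_1,\dots,x_n)\in\Gamma^n$ an $s$-element subset of $\Gamma$, whose value depends only on those coordinates $x_j$ for which $j$ is adjacent to $i$ in $G$. A system of strategies $(F_1,\dots,F_n)$ is winning if for every $(x_1,\dots,x_n)\in\Gamma^n$ there is at least one $i$ with $x_i\in F_i(x_1,\dots,x_n)$. The number $\mu_s(G)$ is the largest integer $k=|\Gamma|$ for which a winning system of strategies exists on $G$, and $\mu(G)=\mu_1(G)$ is the hat chromatic number of $G$. The genus of a graph is the minimum genus of a surface in which it embeds; the girth is the length of a shortest cycle (infinite if there is none). *)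

(* Defs.v *)
From mathcomp Require Import all_boot all_fingroup.

Set Implicit Arguments.
Unset Strict Implicit.
Unset Printing Implicit Defensive.

Record sgraph := SGraph {
  vertex :> finType;
  adj : rel vertex;
  adj_sym : symmetric adj;
  adj_irrefl : irreflexive adj
}.

Section Hats.
Variables (G : sgraph) (s k : nat).

Definition coloring := {ffun G -> 'I_k}.
Definition guess := {ffun coloring -> {set 'I_k}}.

Definition is_strategy (i : G) (F : guess) : bool :=
  [forall x : coloring, #|F x| == s]
  && [forall x : coloring, forall y : coloring,
        [forall j : G, adj i j ==> (x j == y j)] ==> (F x == F y)].

Definition is_winning (F : {ffun G -> guess}) : bool :=
  [forall x : coloring, exists i : G, x i \in F i x].

Definition has_winning_system : bool :=
  [exists F : {ffun G -> guess}, [forall i, is_strategy i (F i)] && is_winning F].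

Lemma has_winning_system_bound : has_winning_system -> k <= s * #|G|.
Proof.
case/existsP=> F /andP[/forallP Fs /forallP Fw].
case: (posnP k) => [-> //|k0].
pose A i := [set x : coloring | x i \in F i x].
pose upd i (p : coloring * 'I_k) : coloring * 'I_k :=
  ([ffun j => if j == i then p.2 else p.1 j], p.1 i).
have updK i : involutive (upd i).
  case=> x c; rewrite /upd /=; congr pair; last by rewrite ffunE eqxx.
  by apply/ffunP=> j; rewrite !ffunE; case: eqP => // ->.
have cardA i : k * #|A i| = s * #|{: coloring}|.
  have -> : k * #|A i| = \sum_(p : coloring * 'I_k) (p.1 \in A i).
    rewrite -(pair_bigA _ (fun x (c : 'I_k) => (x \in A i) : nat)) /=.
    under eq_bigr do rewrite sum_nat_const card_ord.
    by rewrite -big_distrr /= -sum1_card big_mkcond.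
  rewrite (reindex_inj (inv_inj (updK i))) /=.
  rewrite -(pair_bigA _ (fun x c => ((upd i (x, c)).1 \in A i) : nat)) /=.
  rewrite mulnC -sum_nat_const; apply: eq_big => // x _.
  have /andP[/forallP/(_ x)/eqP <- /forallP loc] := Fs i.
  rewrite -sum1_card [RHS]big_mkcond /=; apply: eq_bigr => c _.
  rewrite inE ffunE eqxx.
  set y := [ffun j => _]; have /forallP/(_ x)/implyP yx := loc y.
  rewrite (eqP (yx _)); first by case: (_ \in _).
  apply/forallP=> j; apply/implyP=> ij; rewrite ffunE /=.
  by case: (j =P i) ij => [->|_ _]; rewrite ?adj_irrefl ?eqxx.
have X0 : 0 < #|{: coloring}|.
  by apply/card_gt0P; exists [ffun=> Ordinal k0].
rewrite -(leq_pmul2r X0) mulnAC -mulnA.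
have -> : s * (#|{: coloring}| * #|G|) = \sum_(i : G) k * #|A i|.
  by under eq_bigr do rewrite cardA; rewrite sum_nat_const mulnA mulnC.
rewrite -big_distrr /= leq_mul2l; apply/orP; right.
have -> : #|{: coloring}| = #|\bigcup_(i : G) A i|.
  apply: eq_card => x; rewrite !inE; apply/esym/bigcupP.
  by have /existsP[i xi] := Fw x; exists i; rewrite ?inE.
apply: (big_ind2 (fun (B : {set coloring}) m => #|B| <= m)) => //.
  by rewrite cards0.
move=> B m C p Bm Cp; apply: leq_trans (leq_add Bm Cp).
by rewrite cardsU leq_subr.
Qed.

Lemma has_winning_system_full : 0 < #|G| -> k = s -> has_winning_system.
Proof.
case/card_gt0P=> v _ ks; apply/existsP; exists [ffun=> [ffun=> setT]].
apply/andP; split; last first.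
  by apply/forallP=> x; apply/existsP; exists v; rewrite !ffunE inE.
apply/forallP=> i; rewrite ffunE; apply/andP; split.
  by apply/forallP=> x; rewrite ffunE cardsT card_ord ks.
by apply/forallP=> x; apply/forallP=> y; rewrite !ffunE eqxx implybT.
Qed.

End Hats.

(** The range of the maximum loses nothing, by [has_winning_system_bound]; see
    [leq_hat_number] and [hat_number_winning].  The graph without vertices,
    for which no winning system exists, gets the value 0. *)
Definition hat_number (s : nat) (G : sgraph) : nat :=
  \max_(k < (s * #|G|).+1 | has_winning_system G s k) k.

Lemma leq_hat_number s (G : sgraph) k :
  has_winning_system G s k -> k <= hat_number s G.
Proof.
move=> w; have lt : k < (s * #|G|).+1 by rewrite ltnS has_winning_system_bound.
by apply: (@leq_bigmax_cond _ _ (fun i : 'I__ => i : nat) (Ordinal lt)).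
Qed.

Lemma hat_number_winning s (G : sgraph) :
  0 < #|G| -> has_winning_system G s (hat_number s G).
Proof.
move=> G0; have w := has_winning_system_full G0 (erefl s).
have lt : s < (s * #|G|).+1 by rewrite ltnS has_winning_system_bound.
rewrite /hat_number (bigmax_eq_arg (Ordinal lt)) //.
by case: arg_maxnP.
Qed.

(** A closed connected orientable surface with a cellular decomposition, as a
    combinatorial map: darts are the oriented edges, [edge] reverses a dart and
    [node] turns counterclockwise around its origin.  The vertices, edges and
    faces are the orbits of [node], [edge] and [edge * node].  Loops and
    multiple edges are allowed. *)
Record surface := Surface {
  dart : finType;
  edge : {perm dart};
  node : {perm dart};
  edgeK : involutive edge;
  edge_neq : forall d, edge d != d;
  dart_gt0 : 0 < #|dart|;
  surface_connected : forall d d',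
    connect (fun a b => (b == edge a) || (b == node a)) d d'
}.

(** Euler's formula V - E + F = 2 - 2h. *)
Definition surface_genus (S : surface) (h : nat) : Prop :=
  #|porbits (node S)| + #|porbits (edge S * node S)%g| + h.*2
  = #|porbits (edge S)| + 2.

(** [G] is drawn on [S] along the 1-skeleton.  The decomposition is otherwise
    arbitrary, so neither [G] nor its complement has any cellularity or
    connectedness imposed on it, and every embedding of a finite graph in a
    surface is of this form for some decomposition.  Distinct edges of [G] have
    distinct pairs of ends, hence use distinct edges of [S]. *)
Definition embeds (G : sgraph) (S : surface) : Prop :=
  exists p : G -> {set dart S},
    [/\ injective p,
        forall v, p v \in porbits (node S)
      & forall u v, adj u v ->
          exists2 d, porbit (node S) d = p u & porbit (node S) (edge S d) = p v].

Definition embeds_in_genus (G : sgraph) (h : nat) : Prop :=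
  exists2 S, surface_genus S h & embeds G S.

Definition has_genus (G : sgraph) (h : nat) : Prop :=
  embeds_in_genus G h /\ forall h', embeds_in_genus G h' -> h <= h'.

(** Vacuous when [G] has no cycle, whose girth is infinite.  A walk back and
    forth along one edge is a [ucycle] of size 2, hence the bound 3. *)
Definition girth_at_least (G : sgraph) (g : nat) : Prop :=
  forall c : seq G, 3 <= size c -> ucycle (@adj G) c -> g <= size c.

(* Main.v *)
Require Import Defs.
From mathcomp Require Import all_boot.
From mathcomp Require Import all_fingroup ssralg zmodp matrix mxalgebra rat.
From mathcomp Require Import zify ring.
Set Implicit Arguments.
Unset Strict Implicit.
Unset Printing Implicit Defensive.

(** Put r = s^2 + s.  On a forest, r guesses lose as soon as there are more than
    r(r + 1) colours: a leaf can be merged into its neighbour without increasing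
    the number of guesses.  Now suppose that the vertices split into a set A that
    induces a forest and an independent set B such that every vertex of A has at
    most one neighbour in B.  Restrict each vertex of B to the same s + 1 colours;
    a vertex of A, whatever its neighbour in B shows, then guesses among s(s + 1)
    colours, so A can be coloured so that all of A is wrong in every case.  A vertex
    of B sees only A, and one of its s + 1 colours escapes its s guesses.

    Such a splitting is obtained by repeatedly removing either a vertex of degree
    at most 1, which goes to A, or a ball of radius 2 around a vertex a in which all
    vertices other than a have degree at most 2; then a goes to B and the rest of the
    ball to A.  If neither occurs in an induced subgraph with n vertices and m edges,
    then n <= 14 (m - n).  On the other hand m - n < 2 gamma + f, where f is the
    number of regions cut out of the surface, and if f > 1 then the boundary of each
    region contains a cycle, so f g <= 2 m.  For large g this bounds n in terms of
    gamma, while the minimum degree 2 gives a cycle, hence n >= g. *)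

(** * Forests and splittings *)

Section Forest.
Variables (T : finType) (e : rel T).
Hypotheses (e_sym : symmetric e) (e_irr : irreflexive e).

Definition nbrs (U : {set T}) (v : T) : {set T} := [set w in U | e v w].

(** Encodes that [U] induces a forest: a finite graph is acyclic exactly when every nonempty induced
    subgraph has a vertex of degree at most 1. *)
Definition one_degenerate (U : {set T}) : Prop :=
  forall W : {set T}, W \subset U -> W != set0 ->
    exists2 w, w \in W & #|nbrs W w| <= 1.

Lemma one_degenerateS (U W : {set T}) :
  W \subset U -> one_degenerate U -> one_degenerate W.
Proof. by move=> WU dU Z ZW; apply: dU; apply: subset_trans ZW WU. Qed.

Lemma leq_card_bigcup (I J : finType) (D : {set I}) (X : I -> {set J}) :
  #|\bigcup_(i in D) X i| <= \sum_(i in D) #|X i|.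
Proof.
apply: (big_ind2 (fun (B : {set J}) n => #|B| <= n)) => //; first by rewrite cards0.
move=> B b C c Bb Cc; apply: leq_trans (leq_add Bb Cc).
exact: leq_card_setU.
Qed.

Lemma card_bigcup_leq (I J : finType) (D : {set I}) (X : I -> {set J}) m :
  (forall i, i \in D -> #|X i| <= m) -> #|\bigcup_(i in D) X i| <= #|D| * m.
Proof.
move=> Xm; apply: leq_trans (leq_card_bigcup _ _) _.
by rewrite -sum_nat_const; apply: leq_sum.
Qed.

Lemma exists_subset (I : finType) (B : {set I}) m :
  m <= #|B| -> exists2 C : {set I}, C \subset B & #|C| = m.
Proof.
rewrite -bin_gt0 -cards_draws => /card_gt0P[C].
by rewrite inE => /andP[CB /eqP]; exists C.
Qed.

Lemma exists_notin (I : finType) (B C : {set I}) :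
  #|B| < #|C| -> exists2 c, c \in C & c \notin B.
Proof.
move=> BC; have /subsetPn[c] : ~~ (C \subset B); last by exists c.
by apply: contraL BC => /subset_leq_card; rewrite leqNgt.
Qed.

Section Colouring.
Variable k : nat.
Implicit Types x y : {ffun T -> 'I_k}.

Definition recolour x v c : {ffun T -> 'I_k} :=
  [ffun u => if u == v then c else x u].

(* A leaf [v] is merged into its neighbour [w]: after merging, [w] guesses the
   colours [a] for which no colour of [v] makes both [v] and [w] wrong. *)
Lemma forest_escape r (U : {set T}) (F : T -> {ffun T -> 'I_k} -> {set 'I_k}) :
  r * r.+1 < k -> one_degenerate U ->
  (forall i x, i \in U -> #|F i x| <= r) ->
  (forall i x y, i \in U -> {in nbrs U i, x =1 y} -> F i x = F i y) ->
  exists x, forall i, i \in U -> x i \notin F i x.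
Proof.
move=> rk; have rk' : r < k by apply: leq_ltn_trans rk; rewrite leq_pmulr.
have [n] := ubnP #|U|; elim: n U F => // n IHn U F Un dU Fr Floc.
have [->|U0] := eqVneq U set0.
  by exists [ffun=> Ordinal (leq_ltn_trans (leq0n _) rk)] => i; rewrite inE.
have [v vU dv] := dU U (subxx _) U0.
have card_v : #|U :\ v| < n by move: Un; rewrite (cardsD1 v) vU.
have dUv : one_degenerate (U :\ v) by apply: one_degenerateS dU; apply: subD1set.
have small (B : {set 'I_k}) m : #|B| <= m -> m < k -> exists c, c \notin B.
  move=> Bm mk; have [|c _ cB] := @exists_notin _ B setT; last by exists c.
  by rewrite cardsT card_ord (leq_ltn_trans Bm).
have [Nv0|/set0Pn[w wN]] := eqVneq (nbrs U v) set0.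
  have isol i j : i \in U -> j \in nbrs U i -> j != v.
    move=> iU; rewrite !inE => /andP[_ ij]; apply: contraTneq ij => ->.
    apply/negP=> vi; have : i \in nbrs U v by rewrite !inE iU e_sym.
    by rewrite Nv0 inE.
  have nbrsD i : i \in U -> nbrs (U :\ v) i = nbrs U i.
    move=> iU; apply/setP=> j; have := isol i j iU; rewrite !inE.
    by case: eqP => //= -> /=; case: andP => // ? /(_ isT).
  have [||x xP] := IHn _ F card_v dUv.
  - by move=> i x /setD1P[_ iU]; apply: Fr.
  - by move=> i x y /setD1P[_ iU]; rewrite nbrsD //; apply: Floc.
  have [c cP] := small _ _ (Fr v x vU) rk'.
  exists (recolour x v c) => i iU.
  have -> : F i (recolour x v c) = F i x.
    apply: Floc => // j /(isol i j iU); rewrite ffunE; by case: eqP.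
  rewrite ffunE; case: eqP => [->//|/eqP iv]; apply: xP; by rewrite !inE iv.
have /andP[wU vw] : (w \in U) && e v w by move: wN; rewrite inE.
have wv : w != v by apply: contraTneq vw => ->; rewrite e_irr.
have Nv : nbrs U v = [set w].
  by apply/esym/eqP; rewrite eqEcard sub1set wN cards1.
pose x0 := [ffun=> Ordinal (leq_ltn_trans (leq0n _) rk)] : {ffun T -> 'I_k}.
pose Fv a := F v (recolour x0 w a).
have FvE x : F v x = Fv (x w).
  by apply: Floc => // j; rewrite Nv inE => /eqP->; rewrite ffunE eqxx.
pose Fw x := [set a | [forall c, (c \notin Fv a) ==> (a \in F w (recolour x v c))]].
pose F' i x := if i == w then Fw x else F i x.
have nbrsD i : i \in U -> i != v -> i != w -> nbrs (U :\ v) i = nbrs U i.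
  move=> iU iv iw; apply/setP=> j; rewrite !inE.
  case: eqP => // -> /=; rewrite vU /= e_sym; apply/esym/negbTE/negP=> vi.
  have : i \in nbrs U v by rewrite inE iU.
  by rewrite Nv inE (negbTE iw).
have [||x xP] := IHn _ F' card_v dUv.
- move=> i x /setD1P[iv iU]; rewrite /F'; case: eqP => [_|_]; last exact: Fr.
  (* If [w] had a set [C] of [r + 1] merged guesses, the sets [Fv a] for [a] in [C] would cover at
     most [r * r.+1 < k] colours. With a colour [c] outside them at [v], [w] would guess all of [C]
     in the original game. *)
  rewrite leqNgt; apply/negP=> /exists_subset[C CF Cr].
  have [||c cP] := small (\bigcup_(a in C) Fv a) (#|C| * r).
  + by apply: card_bigcup_leq => a _; apply: Fr.
  + by rewrite Cr mulnC.
  have /subset_leq_card : C \subset F w (recolour x v c).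
    apply/subsetP=> a aC; have := subsetP CF a aC.
    rewrite inE => /forallP/(_ c)/implyP; apply.
    by apply: contra cP => ca; apply/bigcupP; exists a.
  by rewrite Cr; apply/negP; rewrite -ltnNge ltnS Fr.
- move=> i x y /setD1P[iv iU] xy; rewrite /F'; case: eqP => [iw|/eqP iw].
    apply/setP=> a; rewrite !inE; apply: eq_forallb => c; congr (_ ==> _).
    rewrite (Floc w _ (recolour y v c)) // => j.
    rewrite -iw inE => /andP[jU ij]; rewrite !ffunE.
    by case: eqP => // /eqP jv; apply: xy; rewrite !inE jv jU.
  by apply: Floc => //; rewrite -nbrsD.
have := xP w; rewrite !inE wv wU /F' eqxx inE => /(_ isT).
rewrite negb_forall => /existsP[c]; rewrite negb_imply => /andP[cv cw].
exists (recolour x v c) => i iU.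
rewrite [recolour x v c i]ffunE; case: eqP => [->|/eqP iv].
  by rewrite FvE ffunE (negbTE wv).
have [->//|iw] := eqVneq i w.
have := xP i; rewrite !inE iv iU /F' (negbTE iw) => /(_ isT).
suff -> : F i (recolour x v c) = F i x by [].
apply: Floc => // j; rewrite -nbrsD // !inE => /andP[/andP[jv _] _].
by rewrite ffunE (negbTE jv).
Qed.
End Colouring.

Definition splits (U B : {set T}) : Prop :=
  [/\ B \subset U, one_degenerate (U :\: B),
      forall b, b \in B -> nbrs B b = set0
    & forall a, a \in U :\: B -> #|nbrs B a| <= 1].

Lemma nbrsS (U W : {set T}) v : U \subset W -> nbrs U v \subset nbrs W v.
Proof.
move=> UW; apply/subsetP=> u; rewrite !inE => /andP[uU ->].
by rewrite (subsetP UW).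
Qed.

Lemma leq_nbrs (U W : {set T}) v : U \subset W -> #|nbrs U v| <= #|nbrs W v|.
Proof. by move=> UW; apply/subset_leq_card/nbrsS. Qed.

(** The vertex joins the forest: its degree in [U] bounds its degree in every subset and the number
    of its neighbours in [B]. *)
Lemma splits_leaf (U B : {set T}) v :
  v \in U -> #|nbrs U v| <= 1 -> splits (U :\ v) B -> splits U B.
Proof.
move=> vU dv [BU dA indB B1]; have BsU : B \subset U.
  by apply: subset_trans BU (subD1set _ _).
split=> // [W WU W0|a].
  have [vW|vW] := boolP (v \in W).
    exists v => //; apply: leq_trans (leq_nbrs _ _) dv.
    by apply: subset_trans WU (subsetDl _ _).
  apply: dA => //; apply/subsetP=> w wW; have := subsetP WU _ wW.
  by rewrite !inE => /andP[-> ->]; rewrite andbT; apply: contraNneq vW => <-.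
rewrite inE => /andP[aB aU].
have [->|av] := eqVneq a v; first by apply: leq_trans (leq_nbrs _ _) dv.
by apply: B1; rewrite !inE aB av.
Qed.

(* Holds for [z = a] as soon as [a] has a neighbour in [U]. *)
Definition near (U : {set T}) (a z : T) : bool :=
  (z \in nbrs U a) || [exists y in nbrs U a, z \in nbrs U y].

(** The ball contains all neighbours of [a] and misses [B], so [a |: B] is independent. A vertex
    adjacent to [a] has its other neighbours in the ball; one two steps away has at most two
    neighbours, one of them outside [a |: B]. *)
Lemma splits_ball (U B : {set T}) a :
  a \in U -> (forall z, near U a z -> z != a -> #|nbrs U z| <= 2) ->
  splits (U :\: [set z | (z == a) || near U a z]) B -> splits U (a |: B).
Proof.
set N := [set z | _] => aU d2 [BU dA indB B1].
have BUN b : b \in B -> (b \in U) && (b \notin N).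
  by move/(subsetP BU); rewrite inE andbC.
have aN : a \in N by rewrite inE eqxx.
have nbr_a z : z \in U -> e a z -> z \in N.
  by move=> zU az; rewrite /N inE /near inE zU az orbT.
have nbr2 y z : y \in U -> z \in U -> e a y -> e y z -> z \in N.
  move=> yU zU ay yz; rewrite /N inE; apply/orP; right; apply/orP; right.
  by apply/existsP; exists y; rewrite !inE yU ay zU.
have drop1 (X : {set T}) z y : X \subset U -> z \in N -> z != a -> y \in U ->
    e z y -> y \notin X -> #|nbrs X z| <= 1.
  rewrite inE => XU; case: eqP => //= /eqP za Nz _ yU zy yX.
  have yz : y \in nbrs U z by rewrite inE yU.
  have /subset_leq_card sub : nbrs X z \subset nbrs U z :\ y.
    rewrite subsetD1 nbrsS //=; apply: contra yX; by rewrite inE => /andP[].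
  apply: leq_trans sub _; rewrite -ltnS.
  by have := d2 z Nz za; rewrite (cardsD1 y (nbrs U z)) yz.
have aBU : a |: B \subset U.
  by apply/subsetP=> b; rewrite !inE => /orP[/eqP->//|/BUN/andP[]].
have NP z : z \in N -> z != a ->
    e a z \/ exists y, [/\ y \in U, e a y & e y z].
  rewrite inE /near => /orP[->//|/orP[]]; first by rewrite inE => /andP[_]; left.
  case/existsP=> y; rewrite !inE => /andP[/andP[yU ay] /andP[_ yz]] _.
  by right; exists y.
split=> // [W WU W0|b|x].
- have WUU : W \subset U by apply: subset_trans WU (subsetDl _ _).
  have aW : a \notin W.
    by apply/negP=> /(subsetP WU); rewrite !inE eqxx.
  have [/setP WN0|/set0Pn[x /setIP[xW xN]]] := eqVneq (W :&: N) set0.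
    apply: dA => //; apply/subsetP=> w wW; move: (subsetP WU w wW) (WN0 w).
    by rewrite !inE wW /= negb_or => /andP[/andP[_ ->] ->] ->.
  have xa : x != a by apply: contraNneq aW => <-.
  (* Next to [a], the absence of [a] leaves degree at most 1. Two steps away through [y], either [y]
     is in [W] and lacks [a], or [x] lacks [y]. *)
  have [ax|[y [yU ay yx]]] := NP x xN xa.
    by exists x => //; apply: (drop1 W x a); rewrite // e_sym.
  have [yW|yW] := boolP (y \in W).
    exists y => //; apply: (drop1 W y a); rewrite ?nbr_a // 1?e_sym //.
    by apply: contraNneq aW => <-.
  by exists x => //; apply: (drop1 W x y); rewrite // e_sym.
- have aB b' : b' \in B -> ~~ e a b'.
    by move=> /BUN/andP[bU]; apply: contra => /nbr_a->.
  move=> bB; apply/setP=> c; rewrite !inE; apply/negP=> /andP[].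
  case/setU1P: bB => [->|bB]; case/orP=> [/eqP->|cB].
  + by rewrite e_irr.
  + by apply/negP; apply: aB.
  + by rewrite e_sym; apply/negP; apply: aB.
  by move=> bc; have /setP/(_ c) := indB b bB; rewrite !inE cB bc.
rewrite !inE negb_or => /andP[/andP[xa xB] xU].
have [xN|xN] := boolP (x \in N); last first.
  have -> : nbrs (a |: B) x = nbrs B x.
    apply/setP=> c; rewrite !inE; case: eqP => [->|//].
    suff /negbTE-> : ~~ e x a by rewrite !andbF.
    by apply: contra xN; rewrite e_sym; apply: nbr_a.
  by apply: B1; rewrite !inE xB xU andbT; rewrite inE in xN.
have [ax|[y [yU ay yx]]] := NP x xN xa.
  rewrite -(cards1 a); apply: subset_leq_card; apply/subsetP=> c.
  rewrite !inE => /andP[/orP[//|cB] xc].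
  by have /andP[cU /negP[]] := BUN c cB; apply: nbr2 ax xc.
apply: (drop1 _ x y); rewrite // 1?e_sym // !inE negb_or.
have -> : y != a by apply: contraTneq ay => ->; rewrite e_irr.
by apply: contraL (nbr_a y yU ay) => /BUN/andP[].
Qed.

Lemma exists_split (U : {set T}) :
  (forall W : {set T}, W \subset U -> W != set0 ->
     (exists2 v, v \in W & #|nbrs W v| <= 1)
     \/ exists2 a, a \in W &
          forall z, near W a z -> z != a -> #|nbrs W z| <= 2) ->
  exists B, splits U B.
Proof.
have [n] := ubnP #|U|; elim: n U => // n IHn U Un red.
have [->|U0] := eqVneq U set0.
  exists set0; split=> [|W|b|a]; rewrite ?sub0set ?inE //.
  by rewrite set0D subset0 => ->.
have IH (W : {set T}) : W \proper U -> exists B, splits W B.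
  move=> WU; apply: IHn => [|Z ZW].
    by apply: leq_trans (proper_card WU) _; rewrite -ltnS.
  by apply: red; apply: subset_trans ZW (proper_sub WU).
have [[v vU dv]|[a aU d2]] := red U (subxx _) U0.
  by have [B /splits_leaf] := IH _ (properD1 vU); exists B; auto.
have [|B sB] := IH (U :\: [set z | (z == a) || near U a z]).
  rewrite properEneq subsetDl andbT; apply/eqP=> /setP/(_ a).
  by rewrite !inE eqxx aU.
by exists (a |: B); apply: splits_ball.
Qed.
End Forest.

(** * From a splitting to a bound on the number of colours *)

Lemma split_no_winning (G : sgraph) s k (B : {set G}) :
  splits (@adj G) setT B -> (s ^ 2 + s) * (s ^ 2 + s).+1 < k ->
  ~ has_winning_system G s k.
Proof.
set r := s ^ 2 + s; move=> [_ dA indB B1] rk /existsP[F /andP[/forallP Fs /forallP Fw]].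
have rE : s.+1 * s = r by rewrite mulSn addnC.
have Fcard i x : #|F i x| = s by have /andP[/forallP/(_ x)/eqP] := Fs i.
have Floc i (x y : {ffun G -> 'I_k}) : (forall j, adj i j -> x j = y j) -> F i x = F i y.
  move=> xy; have /andP[_ /forallP/(_ x)/forallP/(_ y)/implyP loc] := Fs i.
  by apply/eqP/loc/forallP=> j; apply/implyP=> ij; rewrite xy.
have sk : s.+1 <= #|[set: 'I_k]|.
  rewrite cardsT card_ord; apply: leq_trans rk; rewrite ltnS.
  by apply: leq_trans (leq_addl (s ^ 2) s) _; rewrite leq_pmulr.
have [C _ Cs] := exists_subset sk.
(* All of [B] shows one colour [c]; uniting over [C] turns the guesses in the forest into at most
   [s.+1 * s = r] guesses that ignore [B]. *)
pose fillB (x : {ffun G -> 'I_k}) c : {ffun G -> 'I_k} :=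
  [ffun j => if j \in B then c else x j].
pose FA i x := \bigcup_(c in C) F i (fillB x c).
have [||x xP] := forest_escape (@adj_sym G) (@adj_irrefl G) (F := FA) rk dA.
- by move=> i x _; rewrite -rE -Cs; apply: card_bigcup_leq => c _; rewrite Fcard.
- move=> i x y iA xy; apply: eq_bigr => c _; apply: Floc => j ij; rewrite !ffunE.
  by case: ifP => // jB; apply: xy; rewrite !inE jB.
(* A vertex of [B] has no neighbour in [B], so its colour can be chosen against [x] alone. *)
have /fin_all_exists[f fP] b : exists c, (c \in C) && (c \notin F b x).
  by have [|c cC cF] := @exists_notin _ (F b x) C;
     [rewrite Fcard Cs | exists c; rewrite cC].
pose y : {ffun G -> 'I_k} := [ffun j => if j \in B then f j else x j].
have /existsP[i] := Fw y; apply/negP; rewrite ffunE; have [iB|iB] := boolP (i \in B).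
  have -> : F i y = F i x; last by case/andP: (fP i).
  apply: Floc => j ij; rewrite ffunE; case: ifP => // jB.
  by have /setP/(_ j) := indB i iB; rewrite !inE jB ij.
have iA : i \in setT :\: B by rewrite !inE iB.
have C0 : exists c, c \in C.
  by apply/card_gt0P; rewrite Cs.
(* With a single neighbour [b] in [B], vertex [i] cannot tell [y] from [fillB x (f b)]; with none,
   any [c] serves. *)
have [c cC yc] : exists2 c, c \in C & F i y = F i (fillB x c).
  have [NB0|/set0Pn[b bN]] := eqVneq (nbrs (@adj G) B i) set0.
    have [c cC] := C0; exists c => //; apply: Floc => j ij; rewrite !ffunE.
    by case: ifP => // jB; have /setP/(_ j) := NB0; rewrite !inE jB ij.
  have NB : nbrs (@adj G) B i = [set b].
    by apply/esym/eqP; rewrite eqEcard sub1set bN cards1 B1.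
  exists (f b); first by case/andP: (fP b).
  apply: Floc => j ij; rewrite !ffunE; case: ifP => // jB.
  by have /setP/(_ j) := NB; rewrite !inE jB ij => /esym/eqP->.
rewrite yc; apply: contra (xP i iA) => xi.
by apply/bigcupP; exists c.
Qed.

Lemma split_hat_number (G : sgraph) s (B : {set G}) :
  splits (@adj G) setT B -> hat_number s G <= (s ^ 2 + s) * (s ^ 2 + s + 1).
Proof.
move=> sB; apply/bigmax_leqP => k; rewrite addn1 leqNgt => wk.
by apply/negP=> /(split_no_winning sB).
Qed.

(** * Cycles and degrees *)

(* A longest path of [D]-steps can only be continued to one of its own vertices,
   and not to the last but one. *)
Lemma nonbacktracking_cycle (T : finType) (e D : rel T) u0 v0 :
  symmetric e -> irreflexive e -> subrel D e -> D u0 v0 ->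
  (forall u v, D u v -> exists2 w, w != u & D v w) ->
  exists c, [/\ 3 <= size c, ucycle e c & {in c, forall u, exists v, D u v}].
Proof.
move=> e_sym e_irr De D0 ext; pose P u := [exists v, D u v].
pose goal := exists c, [/\ 3 <= size c, ucycle e c & {in c, forall u, exists v, D u v}].
(* The path is stored backwards: [a] is its current end and [b] the vertex before it. It has [n + 2]
   distinct vertices, which is impossible for [n = #|T|]. *)
suff grow n : goal \/ exists a b s,
    [/\ uniq (a :: b :: s), size s = n, path (fun x y => D y x) a (b :: s)
      & all P (a :: b :: s)].
  have [//|[a [b [s [Us sn _ _]]]]] := grow #|T|.
  have := max_card (mem (a :: b :: s)); rewrite (card_uniqP Us) /= sn.
  by rewrite ltnNge leqW.
elim: n => [|n [gl|[a [b [s [Us sn /= /andP[Dba pth] /and3P[Pa Pb Ps]]]]]]].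
- have [w _ Dvw] := ext _ _ D0.
  right; exists v0, u0, [::]; split=> //=.
  + by rewrite inE andbT; apply: contraTneq (De _ _ D0) => ->; rewrite e_irr.
  + by rewrite D0.
  + have Pv : P v0 by apply/existsP; exists w.
    have Pu : P u0 by apply/existsP; exists v0.
    by rewrite Pv Pu.
- by left.
have [w wb Daw] := ext _ _ Dba.
have wa : w != a by apply: contraTneq (De _ _ Daw) => ->; rewrite e_irr.
have [ws|ws] := boolP (w \in s); last first.
  right; exists w, a, (b :: s); split; rewrite /= ?sn ?Daw ?Dba ?Pa ?Pb ?Ps //.
  - by rewrite !inE (negbTE ws) (negbTE wa) (negbTE wb).
  - by have [w' _ Dww'] := ext _ _ Daw; rewrite !andbT; apply/existsP; exists w'.
left; case/splitPr: ws Us pth Ps {sn} => s1 s2 Us pth Ps.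
exists (a :: b :: rcons s1 w); split; rewrite /= ?size_rcons //.
- apply/andP; split.
    rewrite /= e_sym De // rcons_path last_rcons e_sym De // andbT.
    move: pth; rewrite -cat_rcons cat_path => /andP[pth _].
    by apply: sub_path pth => x y /De; rewrite e_sym.
  by move: Us; rewrite -cat_rcons -!cat_cons cat_uniq => /andP[].
have : all P (a :: b :: rcons s1 w).
  by rewrite /= Pa Pb; move: Ps; rewrite -cat_rcons all_cat => /andP[].
by move=> /allP PP u /PP/existsP.
Qed.

(** Charge [a] to a vertex of degree at least 3 within two steps, and to the middle vertex of the
    path if that one has degree at least 3. A vertex of degree [d] is then charged by itself, its
    neighbours, and one further vertex through each neighbour of degree 2: at most [1 + 2 * d],
    which is at most [7 * (d - 2)] for [d >= 3], with equality at 3. *)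
Lemma card_leq_near (T : finType) (e : rel T) (U : {set T}) :
  symmetric e -> (forall v, v \in U -> 2 <= #|nbrs e U v|) ->
  (forall a, a \in U ->
     exists z, [/\ near e U a z, z != a & 2 < #|nbrs e U z|]) ->
  #|U| <= \sum_(z in U) 7 * (#|nbrs e U z| - 2).
Proof.
move=> e_sym d2 big; pose d z := #|nbrs e U z|.
pose L := [set z in U | 2 < d z].
pose X z := z |: (nbrs e U z :|:
  \bigcup_(y in [set y in nbrs e U z | d y == 2]) (nbrs e U y :\ z)).
have UX : U \subset \bigcup_(z in L) X z.
  apply/subsetP=> a aU; have [z [az za dz]] := big a aU.
  apply/bigcupP; case/orP: az => [|/existsP[y]].
    rewrite inE => /andP[zU az]; exists z; first by rewrite inE zU.
    by rewrite !inE aU e_sym az orbT.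
  rewrite !inE => /and3P[/andP[yU ay] zU yz].
  have := d2 y yU; rewrite leq_eqVlt => /predU1P[dy|dy].
    exists z; first by rewrite inE zU.
    rewrite !inE; apply/orP; right; apply/orP; right; apply/bigcupP; exists y.
      by rewrite !inE yU e_sym yz /d -dy.
    by rewrite !inE eq_sym za aU e_sym.
  by exists y; rewrite ?inE ?yU //= aU e_sym ay orbT.
apply: leq_trans (subset_leq_card UX) _.
apply: leq_trans (leq_card_bigcup _ _) _.
rewrite [X in _ <= X](bigID (mem L)) /=.
apply: leq_trans (leq_addr _ _).
rewrite [X in _ <= X](eq_bigl (mem L)); last first.
  by move=> z; rewrite /= inE; case: (z \in U).
apply: leq_sum => z; rewrite inE => /andP[zU dz].
have XX : #|X z| <= 1 + (d z + d z).
  rewrite /X; apply: leq_trans (leq_card_setU _ _) _; rewrite cards1 leq_add2l.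
  apply: leq_trans (leq_card_setU _ _) _; rewrite leq_add2l.
  apply: leq_trans (@card_bigcup_leq _ _ _ _ 1 _) _ => [y|].
    rewrite !inE => /andP[/andP[yU zy] /eqP dy].
      have zN : z \in nbrs e U y by rewrite inE zU e_sym.
    by move: dy; rewrite /d (cardsD1 z) zN add1n => -[->].
  by rewrite muln1; apply/subset_leq_card/subsetP=> y; rewrite !inE => /andP[].
apply: leq_trans XX _; rewrite -/(d z); move: (d z) dz => n; clear; lia.
Qed.
Unset Printing Implicit Defensive.

(** * Regions of a graph drawn on a surface *)

Section SurfaceRank.
Import GRing.Theory.
Local Open Scope ring_scope.

(** Multiplication by [R] embeds the row space of [A] in dimension [p]; below, [R] reads off a few
    coordinates. *)
Lemma mxrank_leq_inj (K : fieldType) m n p (A : 'M[K]_(m, n)) (R : 'M_(n, p)) :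
  (forall u : 'rV_n, (u <= A)%MS -> u *m R = 0 -> u = 0) -> (\rank A <= p)%N.
Proof.
move=> inj; rewrite -(mxrank_mul_ker A R).
suff -> : (A :&: kermx R)%MS = 0 by rewrite mxrank0 addn0 rank_leq_col.
apply/row_matrixP=> i; rewrite row0; apply: inj.
  by apply: submx_trans (row_sub _ _) (capmxSl _ _).
by apply/sub_kermxP; apply: submx_trans (row_sub _ _) (capmxSr _ _).
Qed.

Lemma sum_indicator (K : pzRingType) n (f : 'I_n -> K) (i : 'I_n) :
  \sum_j f j * (i == j)%:R = f i.
Proof.
rewrite (bigD1 i) //= eqxx mulr1 big1 ?addr0 // => j ji.
by rewrite eq_sym (negbTE ji) mulr0.
Qed.

(* The edge [e] goes from [t e] to [h e] with the faces [l e] and [r e] on its two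
   sides, so that the first hypothesis says that the boundary of a boundary
   vanishes.  A chain supported on [H] plus a boundary of faces vanishes only if
   the faces form a combination of regions, hence such sums fill a space of
   dimension at least [#|H| + nF - #|RP|]; their boundaries live on [VH], which
   bounds this dimension by [#|VH| + (nE - nV + 1)]. *)
Lemma surface_rank (K : fieldType) nV nE nF
    (t h : 'I_nE -> 'I_nV) (l r : 'I_nE -> 'I_nF)
    (H : {set 'I_nE}) (VH : {set 'I_nV}) (RP : {set 'I_nF}) :
  (forall v f, \sum_e ((l e == f)%:R - (r e == f)%:R)
                    * ((t e == v)%:R - (h e == v)%:R) = 0 :> K) ->
  (forall a : 'I_nV -> K, (forall e, a (t e) = a (h e)) ->
     forall v w, a v = a w) ->
  (forall e, e \in H -> (t e \in VH) && (h e \in VH)) ->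
  (forall b : 'I_nF -> K, (forall e, e \notin H -> b (l e) = b (r e)) ->
     (forall f, f \in RP -> b f = 0) -> forall f, b f = 0) ->
  (#|H| + nF + nV <= #|RP| + #|VH| + nE + 1)%N.
Proof.
move=> orth conn HVH reg.
pose dV : 'M[K]_(nE, nV) := \matrix_(e, v) ((t e == v)%:R - (h e == v)%:R).
pose dF : 'M[K]_(nF, nE) := \matrix_(f, e) ((l e == f)%:R - (r e == f)%:R).
have dFV : dF *m dV = 0.
  by apply/matrixP=> f v; rewrite !mxE -[RHS](orth v f);
     apply: eq_bigr => e _; rewrite !mxE.
have aF (b : 'rV_nF) e : (b *m dF) 0 e = b 0 (l e) - b 0 (r e).
  rewrite mxE -(sum_indicator (b 0)) -[X in _ - X](sum_indicator (b 0)) -sumrB.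
  by apply: eq_bigr => f _; rewrite !mxE mulrBr.
have aV (a : 'rV_nV) e : (a *m dV^T) 0 e = a 0 (t e) - a 0 (h e).
  rewrite mxE -(sum_indicator (a 0)) -[X in _ - X](sum_indicator (a 0)) -sumrB.
  by apply: eq_bigr => v _; rewrite !mxE mulrBr.
(* The kernel of the transpose consists of functions constant along edges, hence constant, so one
   coordinate determines them. *)
have rV : (nV <= \rank dV + 1)%N.
  rewrite -mxrank_tr -leq_subLR -mxrank_ker.
  have [V0|V0] := posnP nV; first by apply: leq_trans (rank_leq_row _) _; rewrite V0.
  apply: (@mxrank_leq_inj _ _ _ _ _ (\matrix_(i, j) (i == Ordinal V0)%:R)).
  move=> u /sub_kermxP uV u0; apply/rowP=> v; rewrite mxE.
  rewrite (conn (u 0) _ v (Ordinal V0)).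
    move/matrixP/(_ 0 0): u0; rewrite !mxE => <-.
    rewrite -{1}(sum_indicator (u 0)); apply: eq_bigr => i _.
    by rewrite mxE eq_sym.
  by move=> e; apply/eqP; rewrite -subr_eq0 -aV uV mxE.
pose Q : 'M[K]_(#|H|, nE) := \matrix_(i, e) (enum_val i == e)%:R.
have QE (x : 'rV_#|H|) i : (x *m Q) 0 (enum_val i) = x 0 i.
  rewrite mxE -[RHS](sum_indicator (x 0)); apply: eq_bigr => j _.
  by rewrite mxE (inj_eq enum_val_inj) eq_sym.
have QN (x : 'rV_#|H|) e : e \notin H -> (x *m Q) 0 e = 0.
  move=> eH; rewrite mxE big1 // => i _; rewrite mxE.
  by case: eqP (enum_valP i) => [->|_ _]; rewrite ?(negbTE eH) // mulr0.
pose A := col_mx Q dF.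
(* In a relation [x *m Q + b *m dF = 0], [b] agrees across the edges outside [H], so its values on
   [RP] determine it; [x] is then determined by [b]. *)
have kA : (\rank (kermx A) <= #|RP|)%N.
  pose J : 'M[K]_(nF, #|RP|) := \matrix_(f, i) (enum_val i == f)%:R.
  apply: (@mxrank_leq_inj _ _ _ _ _ (col_mx 0 J)) => u.
  rewrite -[u]hsubmxK; move: (lsubmx u) (rsubmx u) => x b {u}.
  move/sub_kermxP; rewrite !mul_row_col mulmx0 add0r => xb bJ.
  have b0 : b = 0.
    apply/rowP=> f; rewrite [RHS]mxE; apply: reg f => [e eH|f fR].
      apply/eqP; rewrite -subr_eq0 -aF; move/matrixP/(_ 0 e): xb.
      by rewrite mxE QN // add0r => ->; rewrite mxE.
    move/matrixP/(_ 0 (enum_rank_in fR f)): bJ; rewrite !mxE => <-.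
    rewrite -{1}(sum_indicator (b 0)); apply: eq_bigr => i _.
    by rewrite mxE enum_rankK_in.
  move: xb; rewrite b0 mul0mx addr0 => xQ.
  suff -> : x = 0 by rewrite row_mx0.
  by apply/rowP=> i; rewrite -QE xQ !mxE.
have AV : (\rank (A *m dV) <= #|VH|)%N.
  pose J : 'M[K]_(nV, #|VH|) := \matrix_(f, i) (enum_val i == f)%:R.
  apply: (@mxrank_leq_inj _ _ _ _ _ J) => u /submxP[w ->].
  rewrite mulmxA -[w]hsubmxK mul_row_col mulmxDl -[_ *m dF *m _]mulmxA dFV mulmx0 addr0.
  move: (lsubmx w) => x {w} xJ; apply/rowP=> v; rewrite [RHS]mxE.
  have [vH|vH] := boolP (v \in VH).
    move: (x *m Q *m dV) xJ => y /matrixP/(_ 0 (enum_rank_in vH v)).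
    rewrite !mxE => <-; rewrite -{1}(sum_indicator (y 0)); apply: eq_bigr => i _.
    by rewrite mxE enum_rankK_in.
  rewrite mxE big1 // => e _; have [eH|/QN->] := boolP (e \in H); last by rewrite mul0r.
  have /andP[tH hH] := HVH e eH; rewrite [dV e v]mxE.
  have -> : (t e == v) = false by apply: contraNF vH => /eqP<-.
  have -> : (h e == v) = false by apply: contraNF vH => /eqP<-.
  by rewrite subrr mulr0.
have EA : (\rank (A :&: kermx dV) <= nE - \rank dV)%N.
  by rewrite -mxrank_ker; apply/mxrankS/capmxSr.
have := mxrank_mul_ker A dV; have := mxrank_ker A; have := rank_leq_row A.
have := rank_leq_row dV; lia.
Qed.
End SurfaceRank.

Section OrbitIndex.
Variables (T : finType) (f : {perm T}).

Lemma porbit_porbits x : porbit f x \in porbits f.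
Proof. exact: imset_f. Qed.

(** Numbers the orbits so that they can index matrices. *)
Definition orbit_index (x : T) : 'I_#|porbits f| :=
  enum_rank_in (porbit_porbits x) (porbit f x).

Lemma orbit_indexK x : enum_val (orbit_index x) = porbit f x.
Proof. by rewrite enum_rankK_in // porbit_porbits. Qed.

Lemma orbit_index_eq x y :
  (orbit_index x == orbit_index y) = (porbit f x == porbit f y).
Proof. by rewrite -!orbit_indexK (inj_eq enum_val_inj). Qed.

Lemma orbit_index_perm x : orbit_index (f x) = orbit_index x.
Proof.
by apply/eqP; rewrite orbit_index_eq; have := porbit_perm f 1 x; rewrite expg1 => ->.
Qed.

Lemma orbit_index_onto i : exists x, orbit_index x = i.
Proof.
have /imsetP[x _ xi] := enum_valP i.
by exists x; apply: enum_val_inj; rewrite orbit_indexK.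
Qed.

End OrbitIndex.

Arguments orbit_index {T} f x.


Lemma porbit_involution (T : finType) (f : {perm T}) x y :
  involutive f -> porbit f x = porbit f y -> (y == x) || (y == f x).
Proof.
move=> fK /esym xy; have := porbit_id f y; rewrite xy => /porbitP[i ->] {xy}.
elim: i => [|i]; first by rewrite expg0 perm1 eqxx.
by rewrite expgSr permM => /orP[]/eqP->; rewrite ?fK eqxx ?orbT.
Qed.

(** * Regions cut out by a set of darts, and their boundaries *)

Section Regions.
Import GRing.Theory.
Variable S : surface.
Implicit Types d : dart S.
Let face : {perm dart S} := (edge S * node S)%g.

Lemma faceE d : face d = node S (edge S d).
Proof. by rewrite permM. Qed.

(** The orbits of the fixed-point-free involution [edge] are pairs. Choosing a dart in each orients
    the edges, and sums over darts become sums over edges. *)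
Lemma edge_reps : exists dE : 'I_#|porbits (edge S)| -> dart S,
  (forall d, exists i, d = dE i \/ d = edge S (dE i)) /\
  forall (R : Type) (x0 : R) (op : Monoid.com_law x0) (F : dart S -> R),
    \big[op/x0]_i op (F (dE i)) (F (edge S (dE i))) = \big[op/x0]_d F d.
Proof.
have /fin_all_exists[dE dEK] := @orbit_index_onto _ (edge S).
have cases d i : orbit_index (edge S) d = i -> (d == dE i) || (d == edge S (dE i)).
  move=> di; apply: porbit_involution; first exact: edgeK.
  by rewrite -!orbit_indexK dEK di.
exists dE; split=> [d|R x0 op F].
  by exists (orbit_index (edge S) d); have /orP[/eqP|/eqP] := cases d _ erefl; auto.
rewrite [RHS](partition_big (orbit_index (edge S)) predT) //=.
apply: eq_bigr => i _; rewrite (bigD1 (dE i)) ?dEK //=.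
rewrite (bigD1 (edge S (dE i))) /=; last by rewrite orbit_index_perm dEK eqxx edge_neq.
rewrite big1 ?Monoid.mulm1 // => d /andP[/andP[/eqP/cases]].
by case/orP=> ->; rewrite ?andbF.
Qed.

Variable H : {set dart S}.
Hypothesis edgeH : forall d, d \in H -> edge S d \in H.

(* Faces are merged across the edges that do not belong to [H]. *)
Definition same_region d d' : bool :=
  (porbit face d == porbit face d') || (d' == edge S d) && (d \notin H).

Lemma edge_notin d : d \notin H -> edge S d \notin H.
Proof. by apply: contra => /edgeH; rewrite edgeK. Qed.

Lemma same_region_sym : symmetric same_region.
Proof.
suff imp d d' : same_region d d' -> same_region d' d.
  by move=> d d'; apply/idP/idP; apply: imp.
case/orP=> [/eqP dd'|/andP[/eqP-> dH]]; rewrite /same_region ?dd' ?eqxx //.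
by rewrite edgeK eqxx edge_notin ?orbT.
Qed.

Let csym : connect_sym same_region := sym_connect_sym same_region_sym.

Local Notation region := (root same_region).

Definition regions : {set dart S} := [set d | roots same_region d].

Lemma region_face d : region (face d) = region d.
Proof.
apply/(rootP csym); rewrite csym; apply: connect1.
have := porbit_perm face 1 d; rewrite expg1 /same_region => ->.
by rewrite eqxx.
Qed.

Lemma region_edge d : d \notin H -> region (edge S d) = region d.
Proof.
move=> dH; apply/(rootP csym); rewrite csym; apply: connect1.
by rewrite /same_region dH eqxx orbT.
Qed.

(** A dart lies on the side of its own face. Edges with [a] on both sides are left out, since they
    could form dead ends. *)
Definition boundary (a : dart S) : {set dart S} :=
  [set d in H | (region d == a) && (region (edge S d) != a)].

(* Turn around the head of [d], starting inside the region [a], until the last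
   dart before leaving [a]; [edge S d] itself lies outside [a]. *)
Lemma boundary_next a d : d \in boundary a ->
  exists2 d', d' \in boundary a
    & porbit (node S) d' = porbit (node S) (edge S d) /\ d' != edge S d.
Proof.
rewrite inE => /and3P[dH /eqP da eda].
pose z i := (node S ^+ i)%g (edge S d).
have z0 : z 0 = edge S d by rewrite /z expg0 perm1.
have zS i : z i.+1 = node S (z i) by rewrite /z expgSr permM.
(* [edge S d] is outside [a] and recurs after a full turn, while [z 1 = face d] is in [a]; so the
   first positive index outside [a] is at least 2. *)
have [i zi zi1] : exists2 i, region (z i) == a & region (z i.+1) != a.
  pose P i := (0 < i) && (region (z i) != a).
  have exP : exists i, P i.
    exists #[node S]%g; by rewrite /P order_gt0 /z expg_order perm1.
  case: (ex_minnP exP) => -[|[|i]] // /andP[_ Pi] minP.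
    by move: Pi; rewrite zS z0 -faceE region_face da eqxx.
  exists i.+1 => //; apply: contraT => zi; have := minP i.+1.
  by rewrite /P zi ltnn => /(_ isT).
exists (z i); last first.
  split; first by rewrite porbit_perm.
  by apply: contraNneq eda => <-.
(* [edge S (z i)] and [z i.+1] lie on the same face. *)
have ezi : region (edge S (z i)) != a.
  by rewrite -region_face faceE edgeK -zS.
rewrite inE zi ezi !andbT; apply: contraT => zH.
by rewrite (region_edge zH) zi in ezi.
Qed.

(** Without boundary, the darts in [a] would be closed under [edge] and [node], hence would be all
    darts of the connected surface, including [b]. *)
Lemma boundary_neq0 a b :
  a \in regions -> b \in regions -> a != b -> exists d, d \in boundary a.
Proof.
rewrite !inE => /eqP ra /eqP rb ab; apply/set0Pn; apply: contraNneq ab => bd0.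
have edgeP d : region d == a -> region (edge S d) == a.
  move=> da; have [dH|dH] := boolP (d \in H); last by rewrite region_edge.
  by apply: contraT => nda; move/setP/(_ d): bd0; rewrite !inE dH da nda.
have edge_iff d : (region (edge S d) == a) = (region d == a).
  by apply/idP/idP; [move/edgeP; rewrite edgeK | apply: edgeP].
have cl : closed (fun x y => (y == edge S x) || (y == node S x))
    [pred d | region d == a].
  move=> x y /orP[]/eqP->; rewrite !inE ?edge_iff //.
  by rewrite -[x in node S x](edgeK (s := S)) -faceE region_face edge_iff.
have := closed_connect cl (surface_connected a b).
by rewrite !inE ra rb eqxx eq_sym => /esym.
Qed.

Lemma sum_boundary : \sum_(a in regions) #|boundary a| <= #|H|.
Proof.
rewrite -[X in _ <= X]sum1_card.
rewrite [X in _ <= X](partition_big region (mem regions)) /=; last first.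
  by move=> d _; rewrite inE /roots (root_root csym).
apply: leq_sum => a _; rewrite -sum1_card big_mkcond [X in _ <= X]big_mkcond.
by apply: leq_sum => d _; rewrite inE; case: (d \in H); case: (_ == a); case: (_ == a).
Qed.

(** [surface_rank] over the rationals, combined with Euler's formula. The set [H] counts each edge
    as two darts, hence the doubled terms. *)
Lemma leq_regions h (V : {set 'I_#|porbits (node S)|}) :
  surface_genus S h -> (forall d, d \in H -> orbit_index (node S) d \in V) ->
  #|H| + 2 <= 2 * #|regions| + 2 * #|V| + 4 * h.
Proof.
move=> euler HV; have [dE [dE_onto dE_sum]] := edge_reps.
pose vx := orbit_index (node S); pose fx := orbit_index face.
pose HE := [set i | dE i \in H].
have cardH : #|H| = #|HE|.*2.
  rewrite -sum1_card -sum1_card big_mkcond /= -dE_sum [in RHS]big_mkcond /=.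
  rewrite -muln2 big_distrl; apply: eq_bigr => i _; rewrite inE.
  have -> : (edge S (dE i) \in H) = (dE i \in H).
    by apply/idP/idP => /edgeH; rewrite ?edgeK.
  by case: (_ \in H).
pose RP := fx @: regions.
have RPr : #|RP| <= #|regions| by apply: leq_imset_card.
have step i : vx (face i) = vx (edge S i).
  by rewrite faceE; apply: orbit_index_perm.
suff : #|HE| + #|porbits face| + #|porbits (node S)| <=
    #|RP| + #|V| + #|porbits (edge S)| + 1.
  move: euler RPr; rewrite /surface_genus cardH -/face.
  move: #|regions| #|RP| #|V| #|HE|.
  move: #|porbits face| #|porbits (node S)| #|porbits (edge S)|; lia.
apply: (@surface_rank rat _ _ _ (fun i => vx (dE i))
  (fun i => vx (edge S (dE i))) (fun i => fx (dE i)) (fun i => fx (edge S (dE i)))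
  HE V RP).
- move=> v f; pose b d : rat := ((fx d == f)%:R)%R; pose a d : rat := ((vx d == v)%:R)%R.
  (* In the expanded sum, reindexing by [face] cancels the two halves: [b] is invariant under
     [face], and [face d] starts at the head of [d]. *)
  transitivity (\sum_d (b d * a d - b d * a (edge S d)))%R.
    rewrite -dE_sum; apply: eq_bigr => i _; rewrite /= edgeK /a /b; ring.
  rewrite sumrB (reindex_inj (@perm_inj _ face)) /=.
  apply/eqP; rewrite subr_eq0; apply/eqP/eq_bigr => d _.
  by rewrite /a /b step /fx orbit_index_perm.
- move=> a aE v w; have aE' d : a (vx (edge S d)) = a (vx d).
    by have [i [->|->]] := dE_onto d; rewrite ?edgeK aE.
  have [x <-] := orbit_index_onto v; have [y <-] := orbit_index_onto w.
  have cl : closed (fun x y => (y == edge S x) || (y == node S x))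
      [pred d | a (vx d) == a (vx x)].
    by move=> z1 z2 /orP[]/eqP->; rewrite !inE ?aE' // /vx orbit_index_perm.
  have := closed_connect cl (surface_connected x y).
  by rewrite !inE eqxx => /esym/eqP.
- by move=> i; rewrite inE => iH; rewrite !HV // edgeH.
(* [b] is constant on each region and vanishes at its representative. *)
move=> b bE b0 f; have [x <-] := orbit_index_onto f.
have cl : closed same_region [pred d | b (fx d) == b (fx x)].
  move=> z1 z2 /orP[|/andP[/eqP-> zH]]; rewrite !inE.
    by rewrite -orbit_index_eq => /eqP; rewrite /fx => ->.
  suff -> : b (fx (edge S z1)) = b (fx z1) by [].
  have [i [zi|zi]] := dE_onto z1; move: zH; rewrite zi => iH.
    by rewrite -bE // inE.
  by rewrite edgeK -bE // inE; apply: contra iH => /edgeH.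
have := closed_connect cl (connect_root same_region x).
rewrite !inE eqxx => /esym/eqP <-; apply: b0; apply: imset_f.
by rewrite inE /roots (root_root csym).
Qed.
End Regions.

(** The edges of [G] inside [U] are drawn as a set [H] of darts whose size is the degree sum, and
    [n] is its number of regions. Once there are two, the boundary of each contains a cycle of [G],
    and the boundaries are disjoint. *)
Lemma surface_cycles (G : sgraph) (S : surface) h g (U : {set G}) :
  surface_genus S h -> embeds G S -> girth_at_least G g ->
  exists2 n, \sum_(u in U) #|nbrs (@adj G) U u| + 2 <= 2 * n + 2 * #|U| + 4 * h
    & n <= 1 \/ n * g <= \sum_(u in U) #|nbrs (@adj G) U u|.
Proof.
move=> euler [p [p_inj p_node p_adj]] girth; pose e := @adj G.
have e_sym u v : e u v -> e v u by rewrite /e adj_sym.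
have /fin_all_exists[q qE] v : exists d, p v = porbit (node S) d.
  by have /imsetP[d _] := p_node v; exists d.
(* For nonadjacent pairs [q uv.1] is a dummy value. *)
have /fin_all_exists[c cE] (uv : G * G) : exists d : dart S, adj uv.1 uv.2 ->
    porbit (node S) d = p uv.1 /\ porbit (node S) (edge S d) = p uv.2.
  have [/p_adj[d]|_] := boolP (adj uv.1 uv.2); first by exists d.
  by exists (q uv.1).
(* Several edges of [S] may join [p u] to [p v]; [dd] keeps one of them, the same
   in both directions, lest parallel edges form boundaries of length 2. *)
pose dd u v := if enum_rank u < enum_rank v then c (u, v) else edge S (c (v, u)).
have ddE u v : e u v ->
    porbit (node S) (dd u v) = p u /\ dd v u = edge S (dd u v).
  move=> uv; rewrite /dd; case: (ltngtP (enum_rank u) (enum_rank v)) => [_|_|].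
  - by have [] := cE (u, v) uv.
  - by have [|_] := cE (v, u) _; rewrite ?edgeK // /= adj_sym.
  by move/val_inj/enum_rank_inj=> uv'; rewrite uv' /e adj_irrefl in uv.
have dd_tail u v : e u v -> porbit (node S) (dd u v) = p u by case/ddE.
have dd_rev u v : e u v -> edge S (dd u v) = dd v u by case/ddE.
have dd_inj u v u' v' : e u v -> e u' v' -> dd u v = dd u' v' -> u = u' /\ v = v'.
  move=> uv uv' eqd; split; apply: p_inj.
    by rewrite -(dd_tail u v) // eqd dd_tail.
  rewrite -(dd_tail v u (e_sym _ _ uv)) -(dd_rev u v uv) eqd dd_rev //.
  exact: dd_tail (e_sym _ _ uv').
pose A := [set uv : G * G | [&& uv.1 \in U, uv.2 \in U & e uv.1 uv.2]].
pose H := [set dd uv.1 uv.2 | uv in A].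
have HP d : d \in H -> exists u v, [/\ u \in U, v \in U, e u v & d = dd u v].
  by case/imsetP=> -[u v]; rewrite inE => /and3P[/= uU vU uv] ->; exists u, v.
have HI u v : u \in U -> v \in U -> e u v -> dd u v \in H.
  by move=> uU vU uv; apply/imsetP; exists (u, v); rewrite ?inE //= uU vU.
have edgeH d : d \in H -> edge S d \in H.
  by case/HP=> u [v [uU vU uv ->]]; rewrite dd_rev //; apply: HI => //; apply: e_sym.
have cardH : #|H| = \sum_(u in U) #|nbrs e U u|.
  rewrite card_in_imset => [|[u v] [u' v']]; last first.
    rewrite !inE => /and3P[_ _ uv] /and3P[_ _ uv'] /= eqd.
    by have [/= -> ->] := dd_inj _ _ _ _ uv uv' eqd.
  rewrite -sum1_card (eq_bigl (fun uv => (uv.1 \in U) && ((uv.2 \in U) && e uv.1 uv.2))).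
    rewrite -(pair_big_dep (mem U) (fun u v => (v \in U) && e u v) (fun _ _ => 1)) /=.
    by apply: eq_bigr => u _; rewrite -sum1_card; apply: eq_bigl => v; rewrite inE.
  by move=> uv; rewrite inE.
pose V := [set orbit_index (node S) (q u) | u in U].
have VU : #|V| <= #|U| by apply: leq_imset_card.
exists #|regions H|.
  rewrite -cardH; have := leq_regions edgeH (V := V) euler.
  suff HV d : d \in H -> orbit_index (node S) d \in V.
    by move/(_ HV) => Hle; apply: leq_trans Hle _;
      rewrite leq_add2r leq_add2l leq_mul2l VU orbT.
  case/HP=> u [v [uU vU uv ->]]; apply/imsetP; exists u => //.
  by apply/eqP; rewrite orbit_index_eq dd_tail // qE.
case: (leqP #|regions H| 1) => [|n1]; [by left | right].
rewrite -cardH; apply: leq_trans (sum_boundary edgeH).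
rewrite -sum_nat_const; apply: leq_sum => a aR.
have [b bR ab] : exists2 b, b \in regions H & a != b.
  move: n1; rewrite (cardsD1 a) aR ltnS => /card_gt0P[b].
  by rewrite !inE => /andP[ba bR]; exists b; rewrite ?inE // eq_sym.
have [d0 d0a] := boundary_neq0 edgeH aR bR ab.
pose D u v := [&& u \in U, v \in U, e u v & dd u v \in boundary H a].
have DP d : d \in boundary H a -> exists u v, d = dd u v /\ D u v.
  move=> da; have /HP[u [v [uU vU uv dE]]] : d \in H by move: da; rewrite inE => /andP[].
  by exists u, v; split=> //; apply/and4P; rewrite -dE.
have subD : subrel D e by move=> u v /and4P[].
have ext u v : D u v -> exists2 w, w != u & D v w.
  case/and4P=> uU vU uv /(boundary_next edgeH)[d' /DP[v' [w [-> Dvw]]] [tail back]].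
  have /subD vw := Dvw.
  have vv' : v' = v.
    apply: p_inj; rewrite -(dd_tail v' w) // tail dd_rev //.
    by rewrite (dd_tail v u (e_sym _ _ uv)).
  rewrite vv' in Dvw back; exists w => //.
  by apply: contraNneq back => ->; rewrite dd_rev.
have [u0 [v0 [_ D0]]] := DP d0 d0a.
have [z [z3 cyc zD]] := nonbacktracking_cycle (@adj_sym G) (@adj_irrefl G) subD D0 ext.
apply: leq_trans (girth z z3 cyc) _.
have /andP[_ /card_uniqP <-] := cyc.
(* The distinct vertices of the cycle are tails of distinct boundary darts. *)
rewrite -(card_imset _ p_inj).
apply: leq_trans (leq_imset_card (porbit (node S)) _).
apply/subset_leq_card/subsetP=> _ /imsetP[u /zD[v uv] ->].
case/and4P: uv => _ _ uv dda.
by rewrite -(dd_tail u v) // imset_f.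
Qed.

(** * The girth bound and the final count *)

Theorem theorem7 :
  forall gamma : nat, exists g : nat,
  forall G : sgraph, has_genus G gamma -> girth_at_least G g ->
    (forall s : nat, 1 <= s ->
       hat_number s G <= (s ^ 2 + s) * (s ^ 2 + s + 1))
    /\ hat_number 1 G <= 6.
Proof.
(* Let [X] be the sum of [deg - 2] over [U]. Then [#|U| <= 7 * X], the degree sum is at most
   [15 * X], and [X + 2 <= 2 * n + 4 * h]. If [n <= 1], then [#|U| <= 28 * h]. Otherwise
   [60 * n <= 15 * X] gives [X + 4 <= 8 * h], so [#|U| < 56 * h]. Both contradict
   [#|U| >= 60 + 56 * h]. *)
move=> h; exists (60 + 56 * h) => G [[S euler emb] _] girth.
suff [B sB] : exists B, splits (@adj G) setT B.
  have bound s : hat_number s G <= (s ^ 2 + s) * (s ^ 2 + s + 1).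
    exact: split_hat_number sB.
  by split=> [s _|]; [apply: bound | apply: bound 1].
apply: exists_split (@adj_sym G) (@adj_irrefl G) _ _ => U _ U0.
have [/exists_inP leaf|noleaf] := boolP [exists v in U, #|nbrs (@adj G) U v| <= 1].
  by left.
right; pose ok a := [forall z, near (@adj G) U a z ==>
  (z != a) ==> (#|nbrs (@adj G) U z| <= 2)].
have [/exists_inP[a aU /forallP aok]|nok] := boolP [exists a in U, ok a].
  exists a => // z az za; by have := aok z; rewrite az za.
have d2 v : v \in U -> 2 <= #|nbrs (@adj G) U v|.
  move=> vU; rewrite ltnNge; apply: contra noleaf => dv.
  by apply/exists_inP; exists v.
have big a : a \in U ->
    exists z, [/\ near (@adj G) U a z, z != a & 2 < #|nbrs (@adj G) U z|].
  move=> aU; have : ~~ ok a by apply: contra nok => oka; apply/exists_inP; exists a.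
  rewrite negb_forall => /existsP[z]; rewrite !negb_imply -ltnNge.
  by case/and3P; exists z.
have cn := card_leq_near (@adj_sym G) d2 big.
have gU : 60 + 56 * h <= #|U|.
  pose D u v := [&& u \in U, v \in U & @adj G u v].
  have ext u v : D u v -> exists2 w, w != u & D v w.
    case/and3P=> uU vU uv; have := d2 v vU; rewrite (cardsD1 u).
    rewrite inE uU adj_sym uv ltnS => /card_gt0P[w].
    by rewrite !inE => /and3P[wu wU vw]; exists w => //; apply/and3P.
  have [u uU] := set0Pn _ U0.
  have [v] : exists v, v \in nbrs (@adj G) U u.
    by apply/card_gt0P; apply: leq_trans (d2 u uU).
  rewrite inE => /andP[vU uv].
  have Duv : D u v by apply/and3P.
  have subD : subrel D (@adj G) by move=> x y /and3P[].
  have [c [c3 cyc cD]] := nonbacktracking_cycle (@adj_sym G) (@adj_irrefl G) subD Duv ext.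
  apply: leq_trans (girth c c3 cyc) _.
  have /andP[_ /card_uniqP <-] := cyc.
  by apply/subset_leq_card/subsetP=> x /cD[y /and3P[]].
have [n] := surface_cycles U euler emb girth.
have : \sum_(u in U) #|nbrs (@adj G) U u| =
    2 * #|U| + \sum_(u in U) (#|nbrs (@adj G) U u| - 2).
  rewrite mulnC -sum_nat_const -big_split; apply: eq_bigr => u uU /=.
  by rewrite subnKC ?d2.
rewrite -big_distrr /= in cn.
set X := \sum_(u in U) (#|nbrs _ _ _| - 2) in cn *.
set m := \sum_(u in U) #|nbrs _ _ _| => mE mn.
case=> [n1|ng]; first lia.
have : n * 60 <= n * (60 + 56 * h) by rewrite leq_mul2l leq_addr orbT.
lia.
Qed.
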